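(* Let $K\subseteq\mathbb{R}^n$ be an extended second order cone, $\mathcal{A}:\mathbb{R}^n\to\mathbb{R}^m$ a linear map with adjoint $\mathcal{A}^T$, $b\in\mathbb{R}^m$ and $c\in\mathbb{R}^n$. Let $\theta_D=\sup\{b^Ty\mid y\in\mathbb{R}^m,\ c-\mathcal{A}^Ty\in K\}$ be the optimal value of the problem $$\text{(D)}\qquad \sup_y\ b^Ty\quad\text{subject to}\quad c-\mathcal{A}^Ty\in K .$$ Suppose that (D) is strongly feasible, i.e., there is $y$ such that $c-\mathcal{A}^Ty\in\mathrm{ri}\,K$. Let $L=(\mathrm{range}\,\mathcal{A}^T)\cap\{\mathcal{A}^Ty\mid b^Ty=0\}$ and consider a maximal relaxation sequence for $(K,L,c)$. Let $K_\gamma$ be the cone corresponding to the last problem of the sequence, and consider $$\text{(D')}\qquad \sup_y\ b^Ty\quad\text{subject to}\quad c-\mathcal{A}^Ty\in K_\gamma ,$$ with optimal value $\theta_{D'}$, together with the corresponding primal problem $$\text{(P')}\qquad \inf_x\ c^Tx\quad\text{subject to}\quad \mathcal{A}x=b,\ x\in K_\gamma^* .$$ The following properties hold. (i) (D') has a relative interior feasible solution, i.e., there is $y$ with $c-\mathcal{A}^Ty\in\mathrm{ri}\,K_\gamma$, so the corresponding primal problem (P') is attained. (ii) The optimal value $\theta_{D'}$ of (D') satisfies $\theta_{D'}=\theta_D$. If $\theta_{D'}$ is finite, then it is attained in (D').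
   Context: The Lorentz cone in $\mathbb{R}^{k}$ is $\mathcal{K}^{k}=\{x\in\mathbb{R}^{k}\mid x_0\ge\|\overline{x}\|\}$, where $x=(x_0,\ldots,x_{k-1})$, $\overline{x}=(x_1,\ldots,x_{k-1})$ and $\|\cdot\|$ is the Euclidean norm; $\mathcal{K}^1=\{x\in\mathbb{R}\mid x\ge 0\}$. For $x\in\mathcal{K}^k$, its reflection is $x'=(x_0,-\overline{x})$. For $d\in\mathbb{R}^k$, $H_d^k=\{x\in\mathbb{R}^k\mid d^Tx\ge 0\}$ and $\mathrm{h}_d^k=\{\alpha d\mid\alpha\ge 0\}$. The dual cone of $K$ is $K^*=\{s\in\mathbb{R}^n\mid s^Tx\ge 0\ \forall x\in K\}$. An extended second order cone is a direct product $K=K^{n_1}\times\cdots\times K^{n_q}\subseteq\mathbb{R}^n$, $n=n_1+\cdots+n_q$, where each $K^{n_i}\subseteq\mathbb{R}^{n_i}$ is one of: $\{0\}$; $\mathbb{R}^{n_i}$; the Lorentz cone $\mathcal{K}^{n_i}$; a half-space $H_d^{n_i}$ with $d\in\mathcal{K}^{n_i}\setminus\{0\}$; a half-line $\mathrm{h}_d^{n_i}$ with $d\in\mathcal{K}^{n_i}$. For $x\in\mathbb{R}^n$, $x_{n_i}\in\mathbb{R}^{n_i}$ denotes the $i$-th block of $x$. For a non-zero $a\in K$, $\mathcal{H}_1(a,K)=\{i\mid K^{n_i}=\mathcal{K}^{n_i},\ a_{n_i}\in\mathrm{ri}\,\mathcal{K}^{n_i}\}$ and $\mathcal{H}_2(a,K)=\{i\mid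 K^{n_i}=\mathcal{K}^{n_i},\ a_{n_i}\in(\mathrm{relbd}\,\mathcal{K}^{n_i})\setminus\{0\}\}$, where $\mathrm{ri}$ is the relative interior and $\mathrm{relbd}$ the relative boundary. If $\mathcal{H}_1(a,K)\cup\mathcal{H}_2(a,K)\neq\emptyset$, the relaxation of $K$ by $a$ is $\widetilde{K}=\widetilde{K}^{n_1}\times\cdots\times\widetilde{K}^{n_q}$ with $\widetilde{K}^{n_i}=\mathbb{R}^{n_i}$ if $i\in\mathcal{H}_1(a,K)$, $\widetilde{K}^{n_i}=H_{a_{n_i}'}^{n_i}$ if $i\in\mathcal{H}_2(a,K)$, and $\widetilde{K}^{n_i}=K^{n_i}$ otherwise. For a closed convex cone $K$, a linear subspace $L$ of $\mathbb{R}^n$ and $c\in\mathbb{R}^n$, $(K,L,c)$ denotes the feasibility problem: find $x\in K\cap(L+c)$. A relaxation sequence for $(K,L,c)$ is a finite sequence $\{(K_1,L,c),\ldots,(K_\gamma,L,c)\}$ with $K_1=K$ such that every $K_i$ is an extended second order cone and, for each $i>1$, there is $d^{i-1}\in K_{i-1}\cap L$ such that $K_i$ is the relaxation of $K_{i-1}$ by $d^{i-1}$, and $K_{i-1}\subsetneq K_i$. The sequence is maximal if it does not admit further non-trivial relaxations, i.e. it cannot be extended by a further problem $(K_{\gamma+1},L,c)$ to a longer relaxation sequence. The last problem of the sequence is $(K_\gamma,L,c)$. An optimal value is attained if some feasible point has objective value equal to it; a problem is called attained if its optimal value is attained.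
   Formalization: In (i), attainment of (P') is asserted only when the optimal value of (D') is finite; if that value is +∞, (P') is infeasible by weak duality (e.g. K=ℝ, A=1, b=1), so it cannot be attained. *)

(* Defs.v *)
From HB Require Import structures.
From mathcomp Require Import all_boot all_order all_algebra.
From mathcomp Require Import all_classical all_reals all_analysis.

Set Implicit Arguments.
Unset Strict Implicit.
Unset Printing Implicit Defensive.

Import Order.TTheory GRing.Theory Num.Theory.
Import numFieldNormedType.Exports.

Local Open Scope classical_set_scope.
Local Open Scope ring_scope.

Definition dotp (R : realType) (n : nat) (x y : 'cV[R]_n) : R :=
  \sum_i x i 0 * y i 0.

(* The library norm on matrices is the sup norm, hence this definition. *)
Definition enorm (R : realType) (n : nat) (x : 'cV[R]_n) : R :=
  Num.sqrt (dotp x x).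

Definition affine_set (R : realType) (n : nat) (A : set 'cV[R]_n) : Prop :=
  forall x y (t : R), A x -> A y -> A (t *: x + (1 - t) *: y).

Definition affine_hull (R : realType) (n : nat) (C : set 'cV[R]_n)
  : set 'cV[R]_n := smallest (@affine_set R n) C.

Definition ri (R : realType) (n : nat) (C : set 'cV[R]_n) : set 'cV[R]_n :=
  [set x | affine_hull C x /\ \forall y \near x, affine_hull C y -> C y].

Definition relbd (R : realType) (n : nat) (C : set 'cV[R]_n) : set 'cV[R]_n :=
  closure C `\` ri C.

Definition dual_cone (R : realType) (n : nat) (C : set 'cV[R]_n)
  : set 'cV[R]_n := [set s | forall x, C x -> 0 <= dotp s x].

Definition lorentz (R : realType) (k : nat) : set 'cV[R]_k.+1 :=
  [set x | enorm (row' ord0 x) <= x ord0 0].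
Arguments lorentz R k : clear implicits.

Definition reflection (R : realType) (k : nat) (x : 'cV[R]_k.+1)
  : 'cV[R]_k.+1 := \col_i (if i == ord0 then x i 0 else - x i 0).

Definition half_space (R : realType) (n : nat) (d : 'cV[R]_n) : set 'cV[R]_n :=
  [set x | 0 <= dotp d x].

Definition half_line (R : realType) (n : nat) (d : 'cV[R]_n) : set 'cV[R]_n :=
  [set a *: d | a in [set a : R | 0 <= a]].

(* The [i]-th block has dimension [(k i).+1], so that every block is nonempty
   and has a [0]-th coordinate. *)
Definition total_dim (q : nat) (k : 'I_q -> nat) : nat := (\sum_i (k i).+1)%N.

Definition block (R : realType) (q : nat) (k : 'I_q -> nat)
    (x : 'cV[R]_(total_dim k)) (i : 'I_q) : 'cV[R]_(k i).+1 :=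
  @submxcol R q (fun j => (k j).+1) 1 x i.

Definition factors (R : realType) (q : nat) (k : 'I_q -> nat) : Type :=
  forall i : 'I_q, set 'cV[R]_(k i).+1.

Definition direct_product (R : realType) (q : nat) (k : 'I_q -> nat)
    (K : factors R k) : set 'cV[R]_(total_dim k) :=
  [set x | forall i, K i (block x i)].

Definition extended_soc (R : realType) (q : nat) (k : 'I_q -> nat)
    (K : factors R k) : Prop :=
  forall i : 'I_q,
    [\/ K i = [set 0],
        K i = setT,
        K i = lorentz R (k i)
      | (exists d, [/\ lorentz R (k i) d, d <> 0 & K i = half_space d]) \/
        (exists d, lorentz R (k i) d /\ K i = half_line d)].

Definition calH1 (R : realType) (q : nat) (k : 'I_q -> nat)
    (a : 'cV[R]_(total_dim k)) (K : factors R k) : set 'I_q :=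
  [set i | K i = lorentz R (k i) /\ ri (lorentz R (k i)) (block a i)].

Definition calH2 (R : realType) (q : nat) (k : 'I_q -> nat)
    (a : 'cV[R]_(total_dim k)) (K : factors R k) : set 'I_q :=
  [set i | K i = lorentz R (k i) /\
           (relbd (lorentz R (k i)) `\ 0) (block a i)].

Definition relaxation (R : realType) (q : nat) (k : 'I_q -> nat)
    (a : 'cV[R]_(total_dim k)) (K : factors R k) : factors R k :=
  fun i => if i \in calH1 a K then setT
           else if i \in calH2 a K then half_space (reflection (block a i))
           else K i.

Definition is_relaxation (R : realType) (q : nat) (k : 'I_q -> nat)
    (a : 'cV[R]_(total_dim k)) (K K' : factors R k) : Prop :=
  [/\ direct_product K a, a <> 0, (calH1 a K `|` calH2 a K) !=set0
    & K' = relaxation a K].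

(* All the problems of a relaxation sequence for (K, L, c) share L and c, and
   c plays no role in the conditions, so that the sequence is represented by
   the sequence of its cones. *)
Definition relaxation_sequence (R : realType) (q : nat) (k : 'I_q -> nat)
    (K : factors R k) (L : set 'cV[R]_(total_dim k)) (Ks : seq (factors R k))
  : Prop :=
  [/\ (0 < size Ks)%N,
      nth K Ks 0%N = K,
      forall i, (i < size Ks)%N -> extended_soc (nth K Ks i)
    & forall i, (i.+1 < size Ks)%N ->
        let K1 := nth K Ks i in let K2 := nth K Ks i.+1 in
        (exists d, [/\ direct_product K1 d, L d & is_relaxation d K1 K2]) /\
        direct_product K1 `<` direct_product K2].

Definition maximal_relaxation_sequence (R : realType) (q : nat)
    (k : 'I_q -> nat) (K : factors R k) (L : set 'cV[R]_(total_dim k))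
    (Ks : seq (factors R k)) : Prop :=
  relaxation_sequence K L Ks /\
  forall K', ~ relaxation_sequence K L (rcons Ks K').

(* (D) sup <b, y> subject to c - A^T y \in C *)
Definition feasibleD (R : realType) (m n : nat) (A : 'M[R]_(m, n))
    (c : 'cV[R]_n) (C : set 'cV[R]_n) : set 'cV[R]_m :=
  [set y | C (c - A^T *m y)].

Definition valueD (R : realType) (m n : nat) (A : 'M[R]_(m, n))
    (b : 'cV[R]_m) (c : 'cV[R]_n) (C : set 'cV[R]_n) : \bar R :=
  ereal_sup [set (dotp b y)%:E | y in feasibleD A c C].

Definition attainedD (R : realType) (m n : nat) (A : 'M[R]_(m, n))
    (b : 'cV[R]_m) (c : 'cV[R]_n) (C : set 'cV[R]_n) : Prop :=
  exists y, feasibleD A c C y /\ (dotp b y)%:E = valueD A b c C.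

Definition strongly_feasibleD (R : realType) (m n : nat) (A : 'M[R]_(m, n))
    (c : 'cV[R]_n) (C : set 'cV[R]_n) : Prop :=
  exists y : 'cV[R]_m, ri C (c - A^T *m y).

(* (P) inf <c, x> subject to A x = b, x \in C^* *)
Definition feasibleP (R : realType) (m n : nat) (A : 'M[R]_(m, n))
    (b : 'cV[R]_m) (C : set 'cV[R]_n) : set 'cV[R]_n :=
  [set x | A *m x = b /\ dual_cone C x].

Definition valueP (R : realType) (m n : nat) (A : 'M[R]_(m, n))
    (b : 'cV[R]_m) (c : 'cV[R]_n) (C : set 'cV[R]_n) : \bar R :=
  ereal_inf [set (dotp c x)%:E | x in feasibleP A b C].

Definition attainedP (R : realType) (m n : nat) (A : 'M[R]_(m, n))
    (b : 'cV[R]_m) (c : 'cV[R]_n) (C : set 'cV[R]_n) : Prop :=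
  exists x, feasibleP A b C x /\ (dotp c x)%:E = valueP A b c C.

(* Main.v *)
Require Import Defs.
From mathcomp Require Import all_boot all_order all_algebra.
From mathcomp Require Import all_classical all_reals all_analysis.
From mathcomp Require Import ring lra.

Set Implicit Arguments.
Unset Strict Implicit.
Unset Printing Implicit Defensive.

Import Order.TTheory GRing.Theory Num.Theory.
Import numFieldNormedType.Exports.
Local Open Scope classical_set_scope.
Local Open Scope ring_scope.

(** Relaxing the cone by a direction [d = A^T w] of the cone with [<b, w> = 0]
    does not change the value of the dual problem.  Indeed, let [s] be a slack
    for the relaxed cone and [u] a slack in the relative interior of the original
    cone.  For [0 < e < 1], the point [(1 - e) s + e u + t d] is in the original
    cone for large [t] ([relaxation_absorb]): in a block where [d] is interior,
    [d] absorbs everything; in a block where [d] is on the boundary, [d] absorbs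
    every point having a positive product with the reflection of [d], which [u]
    provides strictly and [s] weakly.  The move along [d] does not alter the
    objective, and [e] tends to [0] ([relaxation_value]).  Relative interior
    slacks remain so, by a blockwise comparison ([ri_direct_product],
    [relaxation_strongly_feasible]).

    A maximal sequence stops when all directions [d = A^T w] of the last cone
    with [<b, w> = 0] vanish on its Lorentz blocks, as any other one would yield
    a strictly larger relaxation ([calH_block], [relaxation_proper]).

    Primal attainment is strong duality under the relative interior condition
    ([strong_duality]).  The functional mapping [t c - A^T y] to
    [t theta - <b, y>] is positive on the cone, and M. Riesz's theorem extends it
    to the whole space one dimension at a time ([riesz_extension]).  The
    relative interior enters there through its algebraic form [rel_core]: each
    point of the cone, multiplied by a small scalar, can be subtracted from [u].

    Dual attainment ([attainedD_no_direction]) is a compactness argument.  All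
    factors other than Lorentz cones are polyhedral.  Hence, once the variable
    [y] has been eliminated by Fourier and Motzkin's method, the set of the
    Lorentz parts [s] of the slacks, with their values, is closed
    ([closed_projection]).  Scale nearly optimal slacks by factors [t] such that
    [t + sum of the heads of s = 1]; they stay in a compact set, and a limit
    point exists.  If its scale [t] is positive, dividing by [t] gives an optimal
    solution.  If [t = 0], it is a direction of the cone in the range of [A^T],
    orthogonal to [b] as the value is finite, and with a nonzero Lorentz block:
    the maximality of the sequence excludes it.  *)

(** * Inner product and convex cones *)

Lemma dotpE (R : realType) n (x y : 'cV[R]_n) : dotp x y = (x^T *m y) 0 0.
Proof. by rewrite !mxE; apply: eq_bigr => i _; rewrite !mxE. Qed.

Lemma dotpC (R : realType) n (x y : 'cV[R]_n) : dotp x y = dotp y x.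
Proof. by apply: eq_bigr => i _; rewrite mulrC. Qed.

Lemma dotpDr (R : realType) n (x y z : 'cV[R]_n) :
  dotp x (y + z) = dotp x y + dotp x z.
Proof. by rewrite !dotpE mulmxDr mxE. Qed.

Lemma dotpZr (R : realType) n a (x y : 'cV[R]_n) :
  dotp x (a *: y) = a * dotp x y.
Proof. by rewrite !dotpE -scalemxAr mxE. Qed.

Lemma dotp0r (R : realType) n (x : 'cV[R]_n) : dotp x 0 = 0.
Proof. by rewrite dotpE mulmx0 mxE. Qed.

Lemma dotpNr (R : realType) n (x y : 'cV[R]_n) : dotp x (- y) = - dotp x y.
Proof. by rewrite -scaleN1r dotpZr mulN1r. Qed.

Lemma dotpDl (R : realType) n (x y z : 'cV[R]_n) :
  dotp (x + y) z = dotp x z + dotp y z.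
Proof. by rewrite dotpC dotpDr !(dotpC z). Qed.

Lemma dotpZl (R : realType) n a (x y : 'cV[R]_n) :
  dotp (a *: x) y = a * dotp x y.
Proof. by rewrite dotpC dotpZr dotpC. Qed.

Lemma dotpNl (R : realType) n (x y : 'cV[R]_n) : dotp (- x) y = - dotp x y.
Proof. by rewrite dotpC dotpNr dotpC. Qed.

Lemma dotp_mulmx (R : realType) m n (A : 'M[R]_(m, n)) x y :
  dotp x (A^T *m y) = dotp (A *m x) y.
Proof. by rewrite !dotpE trmx_mul mulmxA. Qed.

Lemma dotp_ge0 (R : realType) n (x : 'cV[R]_n) : 0 <= dotp x x.
Proof. by apply: sumr_ge0 => i _; rewrite -expr2 sqr_ge0. Qed.

Lemma dotp_coord_le (R : realType) n (x : 'cV[R]_n) i :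
  x i 0 ^+ 2 <= dotp x x.
Proof.
rewrite /dotp (bigD1 i) //= expr2 lerDl; apply: sumr_ge0 => j _.
by rewrite -expr2 sqr_ge0.
Qed.

Lemma dotp_deltal (R : realType) n i (x : 'cV[R]_n) :
  dotp (delta_mx i 0) x = x i 0.
Proof.
rewrite /dotp (bigD1 i) //= big1 ?addr0 => [|j /negPf ji]; rewrite mxE ?eqxx ?mul1r //.
by rewrite ji mul0r.
Qed.

Definition convex_cone (R : realType) n (C : set 'cV[R]_n) : Prop :=
  [/\ C 0, forall x y, C x -> C y -> C (x + y)
    & forall a x, 0 <= a -> C x -> C (a *: x)].

(** The relative interior in purely algebraic terms: moving slightly away from
    any point of the set does not leave it. *)
Definition rel_core (R : realType) n (C : set 'cV[R]_n) (u : 'cV[R]_n) : Prop :=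
  C u /\ forall x, C x -> exists2 e, 0 < e & C (u - e *: x).

(** * The Lorentz cone *)

Lemma dotp_split (R : realType) k (x y : 'cV[R]_k.+1) :
  dotp x y = x ord0 0 * y ord0 0 + dotp (row' ord0 x) (row' ord0 y).
Proof.
rewrite /dotp big_ord_recl; congr (_ + _).
by apply: eq_bigr => i _; rewrite !mxE.
Qed.

Lemma lorentzE (R : realType) k (x : 'cV[R]_k.+1) :
  lorentz R k x <->
  0 <= x ord0 0 /\ dotp (row' ord0 x) (row' ord0 x) <= x ord0 0 ^+ 2.
Proof.
rewrite /lorentz /= /enorm; split=> [h|[h0 h1]].
  have h0 : 0 <= x ord0 0 by apply: le_trans h; rewrite sqrtr_ge0.
  by split=> //; rewrite -(sqr_sqrtr (dotp_ge0 _)) ler_pXn2r// nnegrE sqrtr_ge0.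
by rewrite -(ger0_norm h0) -sqrtr_sqr ler_wsqrtr.
Qed.

Lemma lorentz_coord (R : realType) k (x : 'cV[R]_k.+1) i :
  lorentz R k x -> `|x i 0| <= x ord0 0.
Proof.
move=> /lorentzE[h0 h1]; case: (unliftP ord0 i) => [j ->|->]; last by rewrite ger0_norm.
rewrite -(ger0_norm h0) -ler_sqr ?nnegrE // -!normrX !ger0_norm ?sqr_ge0 //.
by apply: le_trans h1; have := @dotp_coord_le _ _ (row' ord0 x) j; rewrite !mxE.
Qed.

Lemma lorentz_eq0 (R : realType) k (x : 'cV[R]_k.+1) :
  lorentz R k x -> x ord0 0 = 0 -> x = 0.
Proof.
move=> lx x0; apply/matrixP => i j; rewrite ord1 mxE.
by apply/eqP; rewrite -normr_le0 -x0 lorentz_coord.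
Qed.

Lemma lorentz_gt0 (R : realType) k (x : 'cV[R]_k.+1) :
  lorentz R k x -> x <> 0 -> 0 < x ord0 0.
Proof.
move=> lx xn0; rewrite lt_neqAle ((lorentzE _).1 lx).1 // andbT eq_sym.
by apply/eqP => /(lorentz_eq0 lx).
Qed.

(** Cauchy-Schwarz on the cone: when both heads are positive, expand
    [0 <= |y0 x - x0 y|^2]. *)
Lemma lorentz_CS (R : realType) k (x y : 'cV[R]_k.+1) :
  lorentz R k x -> lorentz R k y ->
  dotp (row' ord0 x) (row' ord0 y) <= x ord0 0 * y ord0 0.
Proof.
move=> lx ly; have [x00|/eqP x0] := eqVneq (x ord0 0) 0.
  rewrite (lorentz_eq0 lx x00) /dotp big1 ?mxE ?mul0r // => i _.
  by rewrite !mxE mul0r.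
have [y00|/eqP y0] := eqVneq (y ord0 0) 0.
  rewrite (lorentz_eq0 ly y00) /dotp big1 ?mxE ?mulr0 // => i _.
  by rewrite !mxE mulr0.
have x_gt0 : 0 < x ord0 0.
  by rewrite lt_neqAle eq_sym ((lorentzE _).1 lx).1 // andbT; apply/eqP.
have y_gt0 : 0 < y ord0 0.
  by rewrite lt_neqAle eq_sym ((lorentzE _).1 ly).1 // andbT; apply/eqP.
have [[_ hx] [_ hy]] := ((lorentzE _).1 lx, (lorentzE _).1 ly).
move: x_gt0 y_gt0 hx hy; move: (x ord0 0) (y ord0 0) => a c a_gt0 c_gt0.
move: (row' _ x) (row' _ y) => v w hv hw.
have := dotp_ge0 (c *: v - a *: w).
rewrite !(dotpDl, dotpDr, dotpNl, dotpNr, dotpZl, dotpZr) (dotpC w v) => h.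
have ac_gt0 := mulr_gt0 a_gt0 c_gt0.
rewrite -(ler_pM2l ac_gt0).
have : c ^+ 2 * dotp v v <= c ^+ 2 * a ^+ 2 by rewrite ler_wpM2l ?sqr_ge0.
have : a ^+ 2 * dotp w w <= a ^+ 2 * c ^+ 2 by rewrite ler_wpM2l ?sqr_ge0.
nra.
Qed.

Lemma lorentz_cone (R : realType) k : convex_cone (lorentz R k).
Proof.
split.
- apply/lorentzE; rewrite !mxE expr0n; split=> //.
  by rewrite /dotp big1 // => i _; rewrite !mxE mul0r.
- move=> x y lx ly; have CS := lorentz_CS lx ly; apply/lorentzE.
  move: lx ly => /lorentzE[x0 x1] /lorentzE[y0 y1]; rewrite mxE.
  split; first exact: addr_ge0.
  rewrite raddfD /= !(dotpDl, dotpDr) (dotpC (row' _ y)); nra.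
- move=> a x a0 /lorentzE[x0 x1]; apply/lorentzE; rewrite mxE mulr_ge0 //; split=> //.
  have -> : row' ord0 (a *: x) = a *: row' ord0 x by apply/matrixP=> i j; rewrite !mxE.
  by rewrite dotpZl dotpZr mulrA -expr2 exprMn ler_wpM2l ?sqr_ge0.
Qed.

Lemma reflection0 (R : realType) k (a : 'cV[R]_k.+1) :
  reflection a ord0 0 = a ord0 0.
Proof. by rewrite mxE eqxx. Qed.

Lemma row'_reflection (R : realType) k (a : 'cV[R]_k.+1) :
  row' ord0 (reflection a) = - row' ord0 a.
Proof. by apply/matrixP => i j; rewrite !mxE ord1 eq_sym (negPf (neq_lift _ _)). Qed.

Lemma lorentz_reflection (R : realType) k (a : 'cV[R]_k.+1) :
  lorentz R k a -> lorentz R k (reflection a).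
Proof.
move=> /lorentzE la; apply/lorentzE.
by rewrite reflection0 row'_reflection dotpNl dotpNr opprK.
Qed.

Lemma reflection_neq0 (R : realType) k (a : 'cV[R]_k.+1) :
  lorentz R k a -> a <> 0 -> reflection a <> 0.
Proof.
move=> la an0 /matrixP/(_ ord0 0); rewrite reflection0 mxE => a0.
by have := lorentz_gt0 la an0; rewrite a0 ltxx.
Qed.

(** The half-space attached to the reflection of a point of the cone contains
    the cone, which is self-dual. *)
Lemma lorentz_dual (R : realType) k (a x : 'cV[R]_k.+1) :
  lorentz R k a -> lorentz R k x -> 0 <= dotp (reflection a) x.
Proof.
move=> la lx; rewrite dotp_split reflection0 row'_reflection dotpNl subr_ge0.
exact: lorentz_CS.
Qed.

Lemma row'_apex (R : realType) k : row' ord0 (delta_mx ord0 0 : 'cV[R]_k.+1) = 0.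
Proof. by apply/matrixP => i j; rewrite !mxE. Qed.

Lemma lorentz_apex (R : realType) k : lorentz R k (delta_mx ord0 0).
Proof.
apply/lorentzE; rewrite row'_apex mxE !eqxx ler01; split=> //.
by rewrite /dotp big1 ?expr1n // => i _; rewrite !mxE mul0r.
Qed.

(** The square of the head of [z + t a] outgrows the rest of the vector: the
    coefficient of [t] in the difference is [2 <a', z> > 0]. *)
Lemma lorentz_absorb (R : realType) k (a z : 'cV[R]_k.+1) :
  lorentz R k a -> 0 < dotp (reflection a) z ->
  exists2 t0, 0 <= t0 & forall t, t0 <= t -> lorentz R k (z + t *: a).
Proof.
move=> la h.
have an0 : a <> 0.
  move=> a0; move: h; rewrite a0 /dotp big1 ?ltxx // => i _.
  by rewrite !mxE; case: ifP; rewrite ?oppr0 mul0r.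
have a0 := lorentz_gt0 la an0; have [_ a1] := (lorentzE _).1 la.
move: h; rewrite dotp_split reflection0 row'_reflection dotpNl.
set s := _ - _ => s_gt0; pose D := dotp (row' ord0 z) (row' ord0 z).
have D0 : 0 <= D by exact: dotp_ge0.
exists (`|z ord0 0| / a ord0 0 + D / s).
  by rewrite addr_ge0 // divr_ge0 // ltW.
move=> t; set w := `|_| / _; set v := D / s => ht.
have w0 : 0 <= w by rewrite divr_ge0 // ltW.
have v0 : 0 <= v by rewrite divr_ge0 // ltW.
have ew : `|z ord0 0| = w * a ord0 0 by rewrite divfK // gt_eqF.
have ev : D = v * s by rewrite divfK // gt_eqF.
clearbody w v.
have zw : - (w * a ord0 0) <= z ord0 0 by rewrite -ew lerNnormlW.
have wt : w * a ord0 0 <= t * a ord0 0 by rewrite ler_pM2r //; lra.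
apply/lorentzE; rewrite 2!mxE; split; first lra.
have -> : row' ord0 (z + t *: a) = row' ord0 z + t *: row' ord0 a.
  by apply/matrixP=> i j; rewrite !mxE.
rewrite !(dotpDl, dotpDr, dotpZl, dotpZr) -/D (dotpC (row' _ z) (row' _ a)) ev.
have : t ^+ 2 * dotp (row' ord0 a) (row' ord0 a) <= t ^+ 2 * a ord0 0 ^+ 2.
  by rewrite ler_wpM2l ?sqr_ge0.
have : v * s <= t * s by rewrite ler_pM2r //; lra.
have t_ge0 : 0 <= t by lra.
have : 0 <= t * s := mulr_ge0 t_ge0 (ltW s_gt0).
have := sqr_ge0 (z ord0 0); rewrite /s. lra.
Qed.

(** Subtract a multiple of the apex direction [e0], whose product with the
    reflection of [a] is the positive head of [a]. *)
Lemma rel_core_lorentz_dual (R : realType) k (a u : 'cV[R]_k.+1) :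
  lorentz R k a -> a <> 0 -> rel_core (lorentz R k) u ->
  0 < dotp (reflection a) u.
Proof.
move=> la an0 [_ /(_ _ (lorentz_apex R k))[e e0 h]].
have := lorentz_dual la h.
rewrite dotpDr dotpNr dotpZr subr_ge0; apply: lt_le_trans.
by rewrite dotpC dotp_deltal reflection0 mulr_gt0 // lorentz_gt0.
Qed.

(** Every [z] enters the cone after adding a multiple of [e0]; a core point [a]
    minus a small multiple of [e0] is in the cone, so that [a] does at least as
    well as [e0]. *)
Lemma rel_core_lorentz_absorb (R : realType) k (a z : 'cV[R]_k.+1) :
  rel_core (lorentz R k) a ->
  exists2 t0, 0 <= t0 & forall t, t0 <= t -> lorentz R k (z + t *: a).
Proof.
have [_ lD lZ] := lorentz_cone R k; have le := lorentz_apex R k.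
move=> [la /(_ _ le)[e e0 h]].
have [t0 t00 ht] : exists2 t0, 0 <= t0 & forall t, t0 <= t ->
    lorentz R k (z + t *: delta_mx ord0 0).
  have [|/eqP z0] := eqVneq z 0.
    by move=> ->; exists 0 => // t t0; rewrite add0r; exact: lZ.
  (* z + M e0 has a positive head, as lorentz_absorb requires *)
  pose M := 1 + `|z ord0 0|.
  have [||s s0 hs] := @lorentz_absorb _ _ (delta_mx ord0 0)
    (z + M *: delta_mx ord0 0) => //.
    rewrite dotpDr dotpZr dotp_split row'_reflection row'_apex reflection0.
    rewrite dotpNl {1}/dotp big1 ?oppr0 ?addr0; last by move=> i _; rewrite mxE mul0r.
    rewrite dotpC dotp_deltal reflection0 !mxE !eqxx mulr1 mul1r /M.
    have := lerNnormlW (lexx (`|z ord0 0|)); lra.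
  exists (M + s); first by rewrite addr_ge0 // addr_ge0.
  move=> t ts; rewrite (_ : t = M + (t - M)); last by ring.
  by rewrite scalerDl addrA; apply: hs; lra.
exists (t0 / e); first by rewrite divr_ge0 // ltW.
move=> t; rewrite ler_pdivrMr // => tt.
have -> : z + t *: a = (z + (t * e) *: delta_mx ord0 0) + t *: (a - e *: delta_mx ord0 0).
  by apply/matrixP => i j; rewrite !mxE; ring.
by apply: lD (ht _ tt) _; apply: lZ h; rewrite -(pmulr_lge0 _ e0); lra.
Qed.

Lemma closed_ge0 (T : topologicalType) (R : realType) (g : T -> R) :
  continuous g -> closed [set p | 0 <= g p].
Proof.
move=> cg; have := @closed_comp _ _ g [set x | 0 <= x].
by apply; [move=> x _; exact: cg|exact: closed_ge].
Qed.

Lemma continuous_sumr (T : topologicalType) (R : realType) (I : Type)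
    (r : seq I) (P : pred I) (F : I -> T -> R) :
  (forall i, continuous (F i)) ->
  continuous (fun x => \sum_(i <- r | P i) F i x).
Proof.
by move=> cF; apply: continuous_big => [|i _]; [exact: add_continuous|exact: cF].
Qed.

(** * Continuity of the Lorentz form *)

Lemma continuous_lorentz_form (T : topologicalType) (R : realType) k
    (f : T -> 'cV[R]_k.+1) :
  (forall i, continuous (fun p => f p i 0)) ->
  continuous (fun p =>
    f p ord0 0 ^+ 2 - dotp (row' ord0 (f p)) (row' ord0 (f p))).
Proof.
move=> cf.
rewrite (_ : (fun p => _) = (fun p =>
    f p ord0 0 ^+ 2 - \sum_i f p (lift ord0 i) 0 * f p (lift ord0 i) 0)).
  have cs : continuous (fun p => \sum_i f p (lift ord0 i) 0 * f p (lift ord0 i) 0).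
    by apply: continuous_sumr => i p; apply: cvgM; exact: cf.
  by move=> p; apply: cvgB; [rewrite expr2; apply: cvgM; exact: cf|exact: cs].
by apply/funext => p; congr (_ - _); apply: eq_bigr => i _; rewrite !mxE.
Qed.

Lemma closed_lorentz_comp (T : topologicalType) (R : realType) k
    (f : T -> 'cV[R]_k.+1) :
  (forall i, continuous (fun p => f p i 0)) -> closed [set p | lorentz R k (f p)].
Proof.
move=> cf.
rewrite (_ : mkset _ = [set p | 0 <= f p ord0 0] `&` [set p | 0 <=
    f p ord0 0 ^+ 2 - dotp (row' ord0 (f p)) (row' ord0 (f p))]).
  by apply: closedI; apply: closed_ge0 => //; exact: continuous_lorentz_form.
apply/seteqP; split=> p /=; first by move=> /lorentzE[]; rewrite subr_ge0.
by move=> [h0 h1]; apply/lorentzE; split; rewrite // -subr_ge0.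
Qed.
(** * Relative interiors *)

Lemma affine_hull_sub (R : realType) n (C : set 'cV[R]_n) : C `<=` affine_hull C.
Proof. exact: sub_smallest. Qed.

Lemma affine_hullP (R : realType) n (C : set 'cV[R]_n) : affine_set (affine_hull C).
Proof.
move=> x y t hx hy S [affS CS].
exact: affS (hx S (conj affS CS)) (hy S (conj affS CS)).
Qed.

(** An affine hull is transported by any map that commutes with affine
    combinations; this is used for [block] and for the insertion of a block. *)
Lemma affine_hull_map (R : realType) n p (f : 'cV[R]_n -> 'cV[R]_p)
    (C : set 'cV[R]_n) (D : set 'cV[R]_p) :
  (forall x y t, f (t *: x + (1 - t) *: y) = t *: f x + (1 - t) *: f y) ->
  (forall x, C x -> D (f x)) ->
  forall x, affine_hull C x -> affine_hull D (f x).
Proof.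
move=> fA CD x hx S [affS DS]; apply: (hx [set y | S (f y)]); split.
  by move=> y z t Sy Sz /=; rewrite fA; exact: affS.
by move=> y Cy; apply: DS; exact: CD.
Qed.

Lemma ri_sub (R : realType) n (C : set 'cV[R]_n) : ri C `<=` C.
Proof. by move=> x [hx /nbhs_singleton]; apply. Qed.

(** Prolong the segment from [x] to [u] slightly beyond [u]: the end point is in
    the affine hull, hence in [C], and it only has to be rescaled, [C] being a
    cone. *)
Lemma ri_rel_core (R : realType) n (C : set 'cV[R]_n) u :
  convex_cone C -> ri C u -> rel_core C u.
Proof.
move=> [C0 CD CZ] riu; have Cu := ri_sub riu; split=> // x Cx.
case: riu => hu nu.
have cvu : (u + t *: (u - x)) @[t --> (0 : R)] --> u.
  have h : u + t *: (u - x) @[t --> (0 : R)] --> u + (0 : R) *: (u - x).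
    by apply: cvgD; [exact: cvg_cst|apply: cvgZr_tmp; exact: cvg_id].
  by rewrite scale0r addr0 in h.
have : \forall t \near (0 : R), affine_hull C (u + t *: (u - x)) -> C (u + t *: (u - x)).
  exact: (cvu _ nu).
move=> /nbhs_ballP[e /= e0 he].
pose t := e / 2; have t0 : 0 < t by rewrite divr_gt0.
have Cut : C (u + t *: (u - x)).
  apply: he.
    by rewrite /ball /= sub0r normrN gtr0_norm // /t ltr_pdivrMr // ltr_pMr // ltr1n.
  have -> : u + t *: (u - x) = (1 + t) *: u + (1 - (1 + t)) *: x.
    by apply/matrixP => i j; rewrite !mxE; ring.
  by apply: affine_hullP => //; exact: affine_hull_sub.
exists (t / (1 + t)); first by rewrite divr_gt0 // addr_gt0.
have t1 : 1 + t != 0 by rewrite gt_eqF // addr_gt0.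
rewrite (_ : u - _ = (1 + t)^-1 *: (u + t *: (u - x))).
  by apply: CZ => //; rewrite invr_ge0 addr_ge0 // ltW.
by apply/matrixP => i j; rewrite !mxE; field.
Qed.

Lemma continuous_entries (T : topologicalType) (R : realType) m n
    (f : T -> 'M[R]_(m, n)) :
  (forall i j, continuous (fun p => f p i j)) -> continuous f.
Proof.
move=> cf p U [P nP PU].
have : \forall x \near p, forall i j, P i j (f x i j).
  by do 2![apply: filter_forall => ?]; exact: cf.
by apply: filterS => x Px; apply: PU.
Qed.

(** * Blocks *)

Section Blocks.
Variables (R : realType) (q : nat) (k : 'I_q -> nat).
Implicit Types (x y u : 'cV[R]_(total_dim k)) (K : factors R k).

Lemma blockD x y i : block (x + y) i = block x i + block y i.
Proof. exact: submxcolD. Qed.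

Lemma blockZ a x i : block (a *: x) i = a *: block x i.
Proof. by apply/matrixP => r s; rewrite !mxE. Qed.

Lemma blockN x i : block (- x) i = - block x i.
Proof. exact: submxcolN. Qed.

Lemma block0 i : block (0 : 'cV[R]_(total_dim k)) i = 0.
Proof. exact: submxcol0. Qed.

Lemma block_eq x y : (forall i, block x i = block y i) -> x = y.
Proof. by move=> h; apply/mxcolP. Qed.

Definition of_blocks (w : forall i, 'cV[R]_(k i).+1) : 'cV[R]_(total_dim k) :=
  mxcol w.

Lemma of_blocksK w i : block (of_blocks w) i = w i.
Proof. exact: mxcolK. Qed.

Definition set_block u i (w : 'cV[R]_(k i).+1) : 'cV[R]_(total_dim k) :=
  of_blocks (@dfwith _ _ (block u) i w).

Lemma set_block_in u i w : block (@set_block u i w) i = w.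
Proof. by rewrite of_blocksK dfwithin. Qed.

Lemma set_block_out u i w j : i != j -> block (@set_block u i w) j = block u j.
Proof. by move=> ij; rewrite of_blocksK dfwithout. Qed.

Lemma set_block_id u i : set_block u (block u i) = u.
Proof.
apply: block_eq => j; have [->|ij] := eqVneq i j; first exact: set_block_in.
exact: set_block_out.
Qed.

Lemma set_block_affine u i (w z : 'cV[R]_(k i).+1) t :
  set_block u (t *: w + (1 - t) *: z) =
  t *: set_block u w + (1 - t) *: set_block u z.
Proof.
apply: block_eq => j; rewrite blockD !blockZ.
have [<-|ij] := eqVneq i j; first by rewrite !set_block_in.
by rewrite !set_block_out // -scalerDl addrC subrK scale1r.
Qed.

Lemma continuous_block i : continuous (fun x => block x i).
Proof.
apply: continuous_entries => r s.
rewrite (_ : (fun p => _) = (fun x => x (tagnat.Rank i r) s)); last first.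
  by apply/funext => x; rewrite !mxE.
exact: coord_continuous.
Qed.

Lemma continuous_set_block u i : continuous (@set_block u i).
Proof.
have cj j r s : continuous (fun w => block (@set_block u i w) j r s).
  move: r; have [<-|ij] := eqVneq i j => r.
    rewrite (_ : (fun p => _) = (fun w : 'cV_(k i).+1 => w r s)).
      exact: coord_continuous.
    by apply/funext => w; rewrite set_block_in.
  rewrite (_ : (fun p => _) = (fun w => block u j r s)); first exact: cst_continuous.
  by apply/funext => w; rewrite set_block_out.
apply: continuous_entries => r s.
rewrite (_ : (fun p => _) =
    (fun w => block (@set_block u i w) (tagnat.sig1 r) (tagnat.sig2 r) s)).
  exact: cj.
by apply/funext => w; rewrite !mxE tagnat.sig2K.
Qed.

Lemma direct_product_cone K :
  (forall i, convex_cone (K i)) -> convex_cone (direct_product K).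
Proof.
move=> cK; split=> [i|x y Kx Ky i|a x a0 Kx i].
- by rewrite block0; have [] := cK i.
- by rewrite blockD; have [_ KD _] := cK i; exact: KD.
- by rewrite blockZ; have [_ _ KZ] := cK i; exact: KZ.
Qed.

(** The relative interior of a product is the product of the relative
    interiors; the affine hulls are compared through [block] one way and
    through [set_block] the other way. *)
Lemma ri_direct_product K u :
  ri (direct_product K) u <-> forall i, ri (K i) (block u i).
Proof.
split=> [riu i|riu].
  have Ku := ri_sub riu; case: riu => hu nu; split.
    exact: affine_hull_sub.
  have cu : @set_block u i w @[w --> block u i] --> u.
    by rewrite -[X in _ --> X](set_block_id u i); exact: continuous_set_block.
  have : \forall w \near block u i, affine_hull (direct_product K) (@set_block u i w) ->
       direct_product K (@set_block u i w) by exact: (cu _ nu).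
  apply: filterS => w hw hKw.
  rewrite -(@set_block_in u i w); apply: (hw _ i).
  apply: affine_hull_map hKw; first exact: set_block_affine.
  move=> z Kz j; have [<-|ij] := eqVneq i j; first by rewrite set_block_in.
  by rewrite set_block_out.
split; first by apply: affine_hull_sub => i; exact: ri_sub (riu i).
have ni i : \forall y \near u, affine_hull (K i) (block y i) -> K i (block y i).
  by have [_ ni] := riu i; exact: (@continuous_block i u _ ni).
apply: filterS (filter_forall _ ni) => y hy hKy i; apply: hy.
apply: (@affine_hull_map _ _ _ (fun x => block x i) (direct_product K)) hKy
  => [v w t|v]; last exact.
by rewrite blockD !blockZ.
Qed.

End Blocks.
(** * Extension of positive functionals *)

(** A partial linear functional is handled through its graph, which need not be
    known to be functional beforehand: positivity on a cone forces it. *)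
Definition linear_graph (R : realType) n (G : 'cV[R]_n -> R -> Prop) : Prop :=
  (forall x y r s, G x r -> G y s -> G (x + y) (r + s)) /\
  (forall a x r, G x r -> G (a *: x) (a * r)).

Definition positive_on (R : realType) n (C : set 'cV[R]_n)
  (G : 'cV[R]_n -> R -> Prop) : Prop := forall x r, G x r -> C x -> 0 <= r.

Definition graph_adjoin (R : realType) n (G : 'cV[R]_n -> R -> Prop) e rho
    (x : 'cV[R]_n) (r : R) : Prop :=
  exists g s a, [/\ G g s, x = g + a *: e & r = s + a * rho].

Lemma linear_graph_adjoin (R : realType) n (G : 'cV[R]_n -> R -> Prop) e rho :
  linear_graph G -> linear_graph (graph_adjoin G e rho).
Proof.
move=> [GD GZ]; split=> [x y r s|a x r].
  move=> [g [s1 [a [G1 -> ->]]]] [h [s2 [c [G2 -> ->]]]].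
  exists (g + h), (s1 + s2), (a + c); split; [exact: GD| |ring].
  by rewrite scalerDl addrACA.
move=> [g [s [c [Gg -> ->]]]]; exists (a *: g), (a * s), (a * c); split.
- exact: GZ.
- by rewrite scalerDr scalerA.
- ring.
Qed.

Lemma graph_adjoin_sub (R : realType) n (G : 'cV[R]_n -> R -> Prop) e rho x r :
  G x r -> graph_adjoin G e rho x r.
Proof. by exists x, r, 0; rewrite scale0r mul0r !addr0. Qed.

(** One step of the extension.  The value [rho] at [e] has to lie above all
    [- r] with [g + e] in the cone and below all [r] with [g - e] in the cone.
    Positivity of [G] makes these bounds compatible; since a core point [u]
    lies in the domain, bounds of one kind exist as soon as there are bounds of
    the other kind, so that the supremum of the lower ones is legitimate. *)
Lemma riesz_step (R : realType) n (C : set 'cV[R]_n) (G : 'cV[R]_n -> R -> Prop)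
    u r0 e :
  convex_cone C -> rel_core C u -> linear_graph G -> positive_on C G -> G u r0 ->
  exists rho, positive_on C (graph_adjoin G e rho).
Proof.
move=> [C0 CD CZ] [Cu coreu] [GD GZ] pos Gu.
pose low := [set l | exists g r, [/\ G g r, C (g + e) & l = - r]].
have low_le g r l : G g r -> C (g - e) -> low l -> l <= r.
  move=> Gg Cg [h [s [Gh Ch ->]]]; rewrite -subr_ge0 opprK.
  apply: (pos _ _ (GD _ _ _ _ Gg Gh)).
  by rewrite (_ : g + h = (g - e) + (h + e)); [exact: CD|rewrite addrACA addNr addr0].
have other (v : 'cV[R]_n) g r : G g r -> C (g + v) -> exists h s, G h s /\ C (h - v).
  move=> Gg Cg; have [t t0 Ct] := coreu _ Cg.
  exists (t^-1 *: u + -1 *: g), (t^-1 * r0 + -1 * r); split.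
    by apply: GD; exact: GZ.
  rewrite (_ : _ - v = t^-1 *: (u - t *: (g + v))); first last.
    by rewrite scalerBr scalerA mulVf ?gt_eqF // scale1r scaleN1r opprD addrA.
  by apply: CZ => //; rewrite invr_ge0 ltW.
have sup_ok : low !=set0 -> has_sup low.
  move=> ne; split=> //; have [l [g [r [Gg Cg _]]]] := ne.
  by have [h [s [Gh Ch]]] := other _ _ _ Gg Cg; exists s => l' ll; exact: low_le Gh Ch ll.
exists (sup low) => _ _ [g [r [a [Gg -> ->]]]] Ca.
have [a0|a0|a0] := ltgtP a 0.
- pose c := - a^-1; have c0 : 0 < c by rewrite oppr_gt0 invr_lt0.
  have ca : c * a = -1 by rewrite /c mulNr mulVf // lt_eqF.
  have Gc := GZ c _ _ Gg.
  have Cc : C (c *: g - e).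
    by have := CZ _ _ (ltW c0) Ca; rewrite scalerDr scalerA ca scaleN1r.
  have ne : low !=set0.
    have Cc' : C (c *: g + - e) by [].
    have [h [s [Gh]]] := other _ _ _ Gc Cc'.
    by rewrite opprK => Ch; exists (- s), h, s.
  have le : sup low <= c * r.
    by apply: ge_sup => // l ll; exact: low_le Gc Cc ll.
  have : 0 <= c * (r + a * sup low) by rewrite mulrDr mulrA ca mulN1r subr_ge0.
  by rewrite pmulr_rge0.
- pose c := a^-1; have c0 : 0 < c by rewrite invr_gt0.
  have ca : c * a = 1 by rewrite /c mulVf // gt_eqF.
  have Cc : C (c *: g + e).
    by have := CZ _ _ (ltW c0) Ca; rewrite scalerDr scalerA ca scale1r.
  have ll : low (- (c * r)) by exists (c *: g), (c * r); split=> //; exact: GZ.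
  have le : - (c * r) <= sup low.
    by apply: ub_le_sup => //; case: sup_ok => //; exists (- (c * r)).
  have : 0 <= c * (r + a * sup low).
    by rewrite mulrDr mulrA ca mul1r addrC -[c * r]opprK subr_ge0.
  by rewrite pmulr_rge0.
- by move: Ca; rewrite a0 scale0r mul0r !addr0 => Cg; exact: pos Gg Cg.
Qed.

(** M. Riesz's extension theorem: adjoin the basis vectors one at a time. *)
Lemma riesz_extension (R : realType) n (C : set 'cV[R]_n)
    (G : 'cV[R]_n -> R -> Prop) u r0 :
  convex_cone C -> rel_core C u -> linear_graph G -> positive_on C G -> G u r0 ->
  exists f : 'cV[R]_n, (forall x r, G x r -> dotp f x = r) /\ dual_cone C f.
Proof.
move=> cC coreu linG posG Gu.
have [H [linH posH GH Hb]] : exists H : 'cV[R]_n -> R -> Prop,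
    [/\ linear_graph H, positive_on C H, forall x r, G x r -> H x r
      & forall i, i \in enum 'I_n -> exists rho, H (delta_mx i 0) rho].
  elim: (enum _) => [|i s [H [linH posH GH Hb]]]; first by exists G; split.
  have [rho posH'] := riesz_step (delta_mx i 0) cC coreu linH posH (GH _ _ Gu).
  exists (graph_adjoin H (delta_mx i 0) rho); split=> //.
  - exact: linear_graph_adjoin.
  - by move=> x r Gx; apply: graph_adjoin_sub; exact: GH.
  move=> j; rewrite inE => /orP[/eqP ->|/Hb[sg Hsg]]; last first.
    by exists sg; exact: graph_adjoin_sub.
  exists rho; exists (0 *: u), (0 * r0), 1; split.
  - by apply: linH.2; exact: GH.
  - by rewrite scale0r add0r scale1r.
  - by rewrite mul0r add0r mul1r.
have [C0 _ _] := cC; have [HD HZ] := linH.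
have H0 : H 0 0 by have := HZ 0 _ _ (GH _ _ Gu); rewrite scale0r mul0r.
have Huniq x r s : H x r -> H x s -> r <= s.
  move=> Hr Hs; rewrite -subr_ge0; apply: (posH 0) => //.
  by have := HD _ _ _ _ Hs (HZ (-1) _ _ Hr); rewrite scaleN1r subrr mulN1r.
have He i : exists rho, H (delta_mx i 0) rho by apply: Hb; rewrite mem_enum.
have [rho Hrho] := choice He.
pose f : 'cV[R]_n := \col_i rho i.
have Hf x : H x (dotp f x).
  rewrite {1}(matrix_sum_delta x) /dotp.
  elim/big_ind2 : _ => // [*|i _]; first exact: HD.
  rewrite big_ord1 mxE mulrC; exact: HZ.
exists f; split=> [x r Gx|x Cx]; last exact: posH (Hf x) Cx.
by apply/eqP; rewrite eq_le !(Huniq x) //; exact: GH.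
Qed.

(** * Conic strong duality *)

Section Duality.
Variables (R : realType) (m n : nat) (A : 'M[R]_(m, n)) (b : 'cV[R]_m)
  (c : 'cV[R]_n) (C : set 'cV[R]_n).

Lemma valueD_fin_num :
  valueD A b c C \is a fin_num ->
  exists theta, [/\ valueD A b c C = theta%:E,
    forall y, feasibleD A c C y -> dotp b y <= theta &
    forall e, 0 < e -> exists2 y, feasibleD A c C y & theta - e < dotp b y].
Proof.
move=> fin; exists (fine (valueD A b c C)); rewrite fineK //; split=> // [y Fy|e e0].
  by rewrite -lee_fin fineK //; apply: ereal_sup_ubound; exists y.
have [_ [y Fy <-]] := ub_ereal_sup_adherent e0 fin.
rewrite -/(valueD A b c C) -(fineK fin) -EFinB lte_fin => h.
by exists y.
Qed.

Hypothesis cC : convex_cone C.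

(** A direction of recession of (D) along which the objective increased would
    make the value infinite. *)
Lemma recession_le0 theta y0 w :
  (forall y, feasibleD A c C y -> dotp b y <= theta) ->
  feasibleD A c C y0 -> C (- (A^T *m w)) -> dotp b w <= 0.
Proof.
move=> ub Fy0 Cw; rewrite leNgt; apply/negP => w0; have [_ CD CZ] := cC.
pose t := (1 + `|theta - dotp b y0|) / dotp b w.
have t0 : 0 <= t by rewrite divr_ge0 ?ltW.
have := ub (y0 + t *: w); rewrite dotpDr dotpZr divfK ?gt_eqF // => h.
have := ler_norm (theta - dotp b y0); suff : feasibleD A c C (y0 + t *: w) by move/h; lra.
rewrite /feasibleD /= mulmxDr opprD addrA -scalemxAr -scalerN.
by apply: CD => //; exact: CZ.
Qed.

(** The functional [t c - A^T y |-> t theta - <b, y>] is positive on the cone: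
    for [t > 0] this is the definition of [theta], for [t = 0] it is
    [recession_le0], and for [t < 0] adding a feasible slack leads back to the
    case [t = 0].  Its extension to the whole space solves (P). *)
Lemma strong_duality :
  (exists y, rel_core C (c - A^T *m y)) ->
  valueD A b c C \is a fin_num -> attainedP A b c C.
Proof.
move=> [y0 core0] /valueD_fin_num[theta [valE ub appr]].
have [_ CD CZ] := cC; have Fy0 : feasibleD A c C y0 by case: core0.
pose G (x : 'cV[R]_n) (r : R) :=
  exists t y, x = t *: c - A^T *m y /\ r = t * theta - dotp b y.
have linG : linear_graph G.
  split=> [x y r s [t [v [-> ->]]] [t' [v' [-> ->]]]|a x r [t [v [-> ->]]]].
    exists (t + t'), (v + v'); rewrite mulmxDr dotpDr; split; last by ring.
    by rewrite scalerDl opprD addrACA.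
  exists (a * t), (a *: v); rewrite -scalemxAr dotpZr; split; last by ring.
  by rewrite scalerBr scalerA.
have posG : positive_on C G.
  move=> _ _ [t [y [-> ->]]]; have [t0|t0|->] := ltgtP t 0.
  - move=> Cy; rewrite subr_ge0.
    pose s := - t^-1; have s0 : 0 < s by rewrite oppr_gt0 invr_lt0.
    have st : s * t = -1 by rewrite /s mulNr mulVf // lt_eqF.
    have Cs : C (- c - A^T *m (s *: y)).
      by have := CZ _ _ (ltW s0) Cy; rewrite scalerBr scalerA st scaleN1r -scalemxAr.
    have h y' : feasibleD A c C y' -> dotp b y' <= - dotp b (s *: y).
      move=> Fy'; rewrite -subr_le0 opprK -dotpDr; apply: recession_le0 ub Fy0 _.
      have := CD _ _ Fy' Cs; congr C; rewrite mulmxDr opprD addrACA subrr add0r //.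
    have : theta <= - dotp b (s *: y).
      apply/ler_addgt0Pl => e e0; have [y' Fy' lty'] := appr _ e0.
      by have := h _ Fy'; lra.
    rewrite dotpZr -(ler_pM2l s0 (dotp b y)) mulrA st; lra.
  - move=> Cy; rewrite subr_ge0 -(ler_pM2l (x := t^-1)) ?invr_gt0 // mulKf ?gt_eqF //.
    rewrite -dotpZr; apply: ub; rewrite /feasibleD /= -scalemxAr.
    have t1 : 0 <= t^-1 by rewrite invr_ge0 ltW.
    by have := CZ _ _ t1 Cy; rewrite scalerBr scalerA mulVf ?gt_eqF // scale1r.
  - rewrite scale0r mul0r !sub0r => Cy; rewrite oppr_ge0.
    exact: recession_le0 ub Fy0 Cy.
have Gu : G (c - A^T *m y0) (theta - dotp b y0).
  by exists 1, y0; rewrite scale1r mul1r.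
have [f [fG fC]] := riesz_extension cC core0 linG posG Gu.
have fc : dotp f c = theta.
  by apply: fG; exists 1, 0; rewrite scale1r mul1r mulmx0 dotp0r !subr0.
have Af : A *m f = b.
  apply/matrixP => i j; rewrite ord1 -[LHS]dotp_deltal -[RHS]dotp_deltal.
  rewrite !(dotpC (delta_mx _ _)) -dotp_mulmx; apply: fG.
  exists 0, (- delta_mx i 0).
  by rewrite scale0r mul0r !sub0r mulmxN dotpNr !opprK.
exists f; split; first by split.
apply/eqP; rewrite eq_le; apply/andP; split; last by apply: ereal_inf_lbound; exists f.
apply/ereal_infP => _ [x [Ax dx] <-]; rewrite lee_fin (dotpC c f) fc.
apply/ler_addgt0Pl => e e0; have [y Fy lty] := appr _ e0.
have := dx _ Fy; rewrite dotpDr dotpNr dotp_mulmx Ax (dotpC x c); lra.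
Qed.

End Duality.
(** * Relaxation steps *)

(** The product of [a] with its reflection is [a_0^2 - |a_bar|^2].  If it were
    positive, it would be so in a neighbourhood of [a], and [a] would be an
    interior point. *)
Lemma ri_lorentz (R : realType) k (a : 'cV[R]_k.+1) :
  lorentz R k a -> a <> 0 -> ~ ri (lorentz R k) a -> dotp (reflection a) a = 0.
Proof.
move=> la an0 nri; have a0 := lorentz_gt0 la an0.
apply/eqP; rewrite eq_le lorentz_dual // andbT leNgt; apply/negP => gap.
apply: nri; split; first exact: affine_hull_sub.
have cc i : continuous (fun y : 'cV[R]_k.+1 => y i 0) by exact: coord_continuous.
have n0 : \forall y \near a, 0 < (y : 'cV[R]_k.+1) ord0 0.
  exact: (cvgr_gt _ (cc ord0 a) _ a0).
have gap' : 0 < a ord0 0 ^+ 2 - dotp (row' ord0 a) (row' ord0 a).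
  by move: gap; rewrite dotp_split row'_reflection reflection0 dotpNl expr2.
have n1 : \forall y \near a, 0 < (y : 'cV[R]_k.+1) ord0 0 ^+ 2 -
    dotp (row' ord0 y) (row' ord0 y).
  exact: (cvgr_gt _ (continuous_lorentz_form cc (x := a)) _ gap').
apply: filterS2 n0 n1 => y y0 y1 _; apply/lorentzE; split; first exact: ltW.
by rewrite -subr_ge0 ltW.
Qed.

Lemma half_line_cone (R : realType) n (d : 'cV[R]_n) : convex_cone (half_line d).
Proof.
split; first by exists 0; rewrite ?scale0r //=.
- move=> _ _ [a a0 <-] [c c0 <-]; exists (a + c); first exact: addr_ge0.
  by rewrite scalerDl.
- move=> t _ t0 [a a0 <-]; exists (t * a); first exact: mulr_ge0.
  by rewrite scalerA.
Qed.

Lemma half_space_cone (R : realType) n (d : 'cV[R]_n) : convex_cone (half_space d).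
Proof.
rewrite /half_space; split=> /= [|x y hx hy|a x a0 hx].
- by rewrite dotp0r.
- by rewrite dotpDr addr_ge0.
- by rewrite dotpZr mulr_ge0.
Qed.

#[local] Arguments relaxation [R q k] a K i _.

Section Relaxation.
Variables (R : realType) (q : nat) (k : 'I_q -> nat).
Implicit Types (K : factors R k) (d u s : 'cV[R]_(total_dim k)).

Lemma extended_soc_cone K : extended_soc K -> forall i, convex_cone (K i).
Proof.
move=> eK i; case: (eK i) => [->|->|->|[[d [_ _ ->]]|[d [_ ->]]]].
- by split=> /= [|x y -> ->|a x _ ->]; rewrite ?addr0 ?scaler0.
- by split.
- exact: lorentz_cone.
- exact: half_space_cone.
- exact: half_line_cone.
Qed.

Lemma relaxationP d K i :
  [\/ calH1 d K i /\ relaxation d K i = setT,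
      calH2 d K i /\ relaxation d K i = half_space (reflection (block d i))
    | relaxation d K i = K i].
Proof.
rewrite /relaxation; case: ifPn => [/set_mem h|_]; first by constructor 1.
by case: ifPn => [/set_mem h|_]; [constructor 2|constructor 3].
Qed.

Lemma calH_block d K i : direct_product K d -> K i = lorentz R (k i) ->
  block d i <> 0 -> (calH1 d K `|` calH2 d K) i.
Proof.
move=> Kd Ki dn0; have := Kd i; rewrite Ki => ld.
have [rid|nrid] := pselect (ri (lorentz R (k i)) (block d i)); [by left|right].
by split=> //; split=> //; split=> //; exact: subset_closure.
Qed.

Lemma extended_soc_relaxation d K :
  extended_soc K -> direct_product K d -> extended_soc (relaxation d K).
Proof.
move=> eK Kd i; case: (relaxationP d K i) => [[_ ->]|[[Ki [_ /= dn0]] ->]|->].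
- by constructor 2.
- constructor 4; left; exists (reflection (block d i)).
  have := Kd i; rewrite Ki => ld.
  by split=> //; [exact: lorentz_reflection|exact: reflection_neq0].
- exact: eK.
Qed.

Lemma relaxation_sub d K :
  direct_product K d -> direct_product K `<=` direct_product (relaxation d K).
Proof.
move=> Kd x Kx i; have := Kx i.
case: (relaxationP d K i) => [[_ ->]|[[Ki _] ->]|->] //.
by have := Kd i; rewrite Ki => ld lx; exact: lorentz_dual.
Qed.

(** A relaxed block strictly grows: it contains [- d_i] if [d_i] is on the
    boundary, and everything if [d_i] is interior. *)
Lemma relaxation_proper d K i :
  extended_soc K -> direct_product K d -> K i = lorentz R (k i) ->
  block d i <> 0 -> direct_product K `<` direct_product (relaxation d K).
Proof.
move=> eK Kd Ki dn0; split; first exact: relaxation_sub.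
have ld : lorentz R (k i) (block d i) by rewrite -Ki.
pose x := set_block 0 (- block d i).
have Kx : direct_product (relaxation d K) x.
  move=> j; have [ij|ij] := eqVneq i j; last first.
    rewrite set_block_out // block0.
    by have [] := extended_soc_cone (extended_soc_relaxation eK Kd) j.
  rewrite -ij set_block_in /relaxation.
  case: ifPn => //; rewrite notin_setE => nH1.
  have nri : ~ ri (lorentz R (k i)) (block d i) by move=> h; apply: nH1.
  rewrite mem_set; last by have [] := calH_block Kd Ki dn0.
  by rewrite /half_space /= dotpNr ri_lorentz // oppr0.
move=> /(_ x Kx) /(_ i); rewrite set_block_in Ki => /lorentzE[]; rewrite mxE oppr_ge0.
by rewrite leNgt lorentz_gt0.
Qed.

(** Far enough in the direction [d], every point in the relative interior of
    the segment joining a relaxed slack to a relative interior point of the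
    original cone comes back to the original cone. *)
Lemma relaxation_absorb d K s u e :
  extended_soc K -> direct_product K d -> ri (direct_product K) u ->
  direct_product (relaxation d K) s -> 0 < e < 1 ->
  exists t, direct_product K ((1 - e) *: s + e *: u + t *: d).
Proof.
move=> eK Kd /ri_direct_product riu Ks /andP[e0 e1].
have e1' : 0 < 1 - e by rewrite subr_gt0.
pose z := (1 - e) *: s + e *: u.
have Hi i : exists t0, 0 <= t0 /\ forall t, t0 <= t -> K i (block z i + t *: block d i).
  have [K0 KD KZ] := extended_soc_cone eK i; have Kdi := Kd i.
  have := Ks i; case: (relaxationP d K i) => [[[Ki rid] _] _|[[Ki [_ /= dn0]] ->]|->].
  - have core := ri_rel_core (lorentz_cone R (k i)) rid.
    have [t0 t00 ht] := rel_core_lorentz_absorb (block z i) core.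
    by exists t0; split=> // t; rewrite Ki; exact: ht.
  - move=> hs; rewrite Ki in Kdi.
    have riui := riu i; rewrite Ki in riui.
    have core := ri_rel_core (lorentz_cone R (k i)) riui.
    have [|t0 t00 ht] := @lorentz_absorb _ _ (block d i) (block z i) Kdi.
      rewrite blockD !blockZ dotpDr !dotpZr ltr_wpDl ?mulr_ge0 ?(ltW e1') //.
      by rewrite mulr_gt0 // rel_core_lorentz_dual.
    by exists t0; split=> // t; rewrite Ki; exact: ht.
  - move=> Ksi; exists 0; split=> // t t0; rewrite blockD !blockZ.
    have Kui := ri_sub (riu i).
    by apply: (KD); [apply: (KD)|]; apply: (KZ) => //; exact: ltW.
have [t0 ht] := choice Hi.
exists (\sum_i t0 i) => i; rewrite blockD [block (_ *: d) i]blockZ.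
apply: (ht i).2; rewrite (bigD1 i) //= lerDl; apply: sumr_ge0 => j _.
exact: (ht j).1.
Qed.

Variables (m : nat) (A : 'M[R]_(m, total_dim k)) (b : 'cV[R]_m)
  (c : 'cV[R]_(total_dim k)).

Lemma relaxation_strongly_feasible d K :
  extended_soc K -> direct_product K d ->
  strongly_feasibleD A c (direct_product K) ->
  strongly_feasibleD A c (direct_product (relaxation d K)).
Proof.
move=> eK Kd [y riy]; exists y; apply/ri_direct_product => i.
move/ri_direct_product/(_ i): riy; set u := block _ i => riu.
case: (relaxationP d K i) => [[_ ->]|[[Ki [_ /= dn0]] ->]|-> //].
  split; first exact: affine_hull_sub.
  by apply: filterE => x _.
have Kdi := Kd i; rewrite Ki in Kdi riu.
have u_gt0 := rel_core_lorentz_dual Kdi dn0 (ri_rel_core (lorentz_cone R (k i)) riu).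
split; first by apply: affine_hull_sub; exact: ltW.
have cd : continuous (fun x : 'cV[R]_(k i).+1 => dotp (reflection (block d i)) x).
  rewrite /dotp; apply: continuous_sumr => j x.
  have cj : (y : 'cV[R]_(k i).+1) j 0 @[y --> x] --> x j 0 by exact: coord_continuous.
  exact: (cvgM (cvg_cst _) cj).
have nu : \forall x \near u, 0 < dotp (reflection (block d i)) x.
  exact: (cvgr_gt _ (cd u) _ u_gt0).
by apply: filterS nu => x x0 _; exact: ltW.
Qed.

(** Moving along [d = A^T w] with [<b, w> = 0] does not change the objective,
    so that any value reached on the relaxed cone is approached on the original
    one. *)
Lemma relaxation_value w K :
  extended_soc K -> direct_product K (A^T *m w) -> dotp b w = 0 ->
  strongly_feasibleD A c (direct_product K) ->
  valueD A b c (direct_product (relaxation (A^T *m w) K)) =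
  valueD A b c (direct_product K).
Proof.
move=> eK Kd bw [y0 ri0]; apply/eqP; rewrite eq_le; apply/andP; split; last first.
  apply: ereal_sup_le => _ [y Fy <-]; exists y => //.
  exact: relaxation_sub Fy.
apply/ereal_supP => _ [y Fy <-]; set v := valueD _ _ _ _.
have step (e : R) : 0 < e < 1 -> (((1 - e) * dotp b y + e * dotp b y0)%:E <= v)%E.
  move=> he; have [t Kt] := relaxation_absorb eK Kd ri0 Fy he.
  apply: ereal_sup_ubound; exists ((1 - e) *: y + e *: y0 - t *: w); last first.
    by rewrite !(dotpDr, dotpNr, dotpZr) bw mulr0 subr0.
  rewrite /feasibleD /=; move: Kt; congr (direct_product K).
  rewrite !(mulmxDr, mulmxN) -!scalemxAr.
  by apply/matrixP => i j; rewrite !mxE; ring.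
case: v step => [r| |] step; last 2 first.
- by rewrite leey.
- have half : 0 < (2^-1 : R) < 1 by rewrite invr_gt0 ltr0n invf_lt1 ?ltr0n // ltr1n.
  by have := step _ half; rewrite leeNy_eq.
rewrite lee_fin leNgt; apply/negP => lt_r.
(* e is chosen such that e D < g, where g is the supposed excess over r *)
pose D := `|dotp b y - dotp b y0|; have D0 : 0 <= D by exact: normr_ge0.
have hD : dotp b y - dotp b y0 <= D by exact: ler_norm.
pose g := dotp b y - r; have g0 : 0 < g by rewrite subr_gt0.
pose e := g / (g + D + 1); have p0 : 0 < g + D + 1 by lra.
have e0 : 0 < e by rewrite divr_gt0.
have e1 : e < 1 by rewrite ltr_pdivrMr // mul1r; lra.
have := step e; rewrite e0 e1 lee_fin => /(_ isT).
have : e * (g + D + 1) = g by rewrite divfK // gt_eqF.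
have : e * (dotp b y - dotp b y0) <= e * D by rewrite ler_wpM2l // ltW.
have : 0 < e * g by rewrite mulr_gt0.
rewrite /g; clearbody e; nra.
Qed.

End Relaxation.
(** * Projections of polyhedra *)

Lemma seq_between (R : realType) (s t : seq R) :
  (forall x y, x \in s -> y \in t -> x <= y) ->
  exists r, (forall x, x \in s -> x <= r) /\ (forall y, y \in t -> r <= y).
Proof.
elim: s => [_|x s IHs h].
  elim: t => [|y t [r [_ hr]]]; first by exists 0.
  exists (Num.min y r); split=> // z; rewrite inE ge_min => /orP[/eqP->|/hr ->].
    by rewrite lexx.
  by rewrite orbT.
have [|r [hs ht]] := IHs; first by move=> y z ys; apply: h; rewrite inE ys orbT.
exists (Num.max x r); split=> y; first rewrite inE le_max => /orP[/eqP->|/hs ->].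
- by rewrite lexx.
- by rewrite orbT.
- by move=> yt; rewrite ge_max ht // h // mem_head.
Qed.

(** [fm_comb gi gj ai aj >= 0] is the consequence, without [r], of the pair of
    inequalities [gi + ai r >= 0] and [gj + aj r >= 0] when [ai = 0] or when
    [ai > 0 > aj]; for other signs it is trivial, which makes it possible to
    index the new system by all pairs. *)
Definition fm_comb (R : realType) (gi gj ai aj : R) : R :=
  if ai == 0 then gi else if (0 < ai) && (aj < 0) then ai * gj - aj * gi else 0.

Lemma fourier_motzkin (R : realType) (I : finType) (g a : I -> R) :
  (exists r, forall i, 0 <= g i + a i * r) <->
  (forall i j, 0 <= fm_comb (g i) (g j) (a i) (a j)).
Proof.
split=> [[r hr] i j|h].
  rewrite /fm_comb; have := hr i; case: eqP => [->|_]; first by rewrite mul0r addr0.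
  case: ifP => // /andP[ai aj] gi; have gj := hr j.
  have : 0 <= a i * (g j + a j * r) by rewrite mulr_ge0 // ltW.
  have : 0 <= - a j * (g i + a i * r) by rewrite mulr_ge0 // oppr_ge0 ltW.
  lra.
pose bound i := - g i / a i.
have [x y|r [hlow hup]] := @seq_between _ [seq bound i | i <- enum I & 0 < a i]
    [seq bound i | i <- enum I & a i < 0].
  move=> /mapP[i]; rewrite mem_filter => /andP[ai _] ->.
  move=> /mapP[j]; rewrite mem_filter => /andP[aj _] ->.
  have := h i j; rewrite /fm_comb gt_eqF // ai aj /= => hij.
  rewrite /bound ler_pdivrMr // mulrAC ler_ndivlMr //; lra.
exists r => i; have [ai|ai|ai] := ltgtP (a i) 0.
- have : r <= bound i by apply: hup; rewrite map_f // mem_filter ai mem_enum.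
  rewrite /bound ler_ndivlMr //; lra.
- have : bound i <= r by apply: hlow; rewrite map_f // mem_filter ai mem_enum.
  rewrite /bound ler_pdivrMr //; lra.
- by have := h i i; rewrite /fm_comb ai eqxx mul0r addr0.
Qed.

(** The variables are eliminated one by one; each elimination only forms linear
    combinations of the [g i], so that what remains are finitely many conditions
    [0 <= g p] with [g] continuous. *)
Lemma closed_projection (T : topologicalType) (R : realType) m (I : finType)
    (g : I -> T -> R) (a : I -> 'I_m -> R) :
  (forall i, continuous (g i)) ->
  closed [set p | exists y : 'I_m -> R, forall i, 0 <= g i p + \sum_j a i j * y j].
Proof.
elim: m I g a => [|m IHm] I g a cg.
  rewrite (_ : mkset _ = \bigcap_(i in setT) [set p | 0 <= g i p]).
    by apply: closed_bigI => i _; apply: closed_ge0.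
  apply/seteqP; split=> [p [y hy] i _|p hp].
    by have := hy i; rewrite big_ord0 addr0.
  by exists (fun=> 0) => i; rewrite big_ord0 addr0; exact: hp.
pose g' (ij : I * I) p := fm_comb (g ij.1 p) (g ij.2 p) (a ij.1 ord0) (a ij.2 ord0).
pose a' (ij : I * I) j := fm_comb (a ij.1 (lift ord0 j)) (a ij.2 (lift ord0 j))
  (a ij.1 ord0) (a ij.2 ord0).
have cg' ij : continuous (g' ij).
  move=> p; rewrite /g' /fm_comb; case: (a ij.1 ord0 == 0); first exact: cg.
  case: ((0 < a ij.1 ord0) && (a ij.2 ord0 < 0)); last exact: cvg_cst.
  by apply: cvgB; apply: cvgM; (exact: cg || exact: cvg_cst).
have comb (y : 'I_m -> R) p ij : g' ij p + \sum_j a' ij j * y j =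
    fm_comb (g ij.1 p + \sum_j a ij.1 (lift ord0 j) * y j)
            (g ij.2 p + \sum_j a ij.2 (lift ord0 j) * y j) (a ij.1 ord0) (a ij.2 ord0).
  rewrite /g' /a' /fm_comb; case: eqP => // _; case: ifP => _; last first.
    by rewrite big1 ?addr0 // => j _; rewrite mul0r.
  rewrite !mulrDr opprD addrACA; congr (_ + _).
  rewrite !mulr_sumr -sumrB; apply: eq_bigr => j _; ring.
have := IHm _ g' a' cg'; congr closed; apply/seteqP; split=> p /= [y hy].
  have h i j : 0 <= fm_comb (g i p + \sum_j a i (lift ord0 j) * y j)
      (g j p + \sum_l a j (lift ord0 l) * y l) (a i ord0) (a j ord0).
    by have := hy (i, j); rewrite comb.
  have [r hr] := (fourier_motzkin _ _).2 h.
  exists (fun j => oapp y r (unlift ord0 j)) => i.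
  rewrite big_ord_recl unlift_none /= addrCA addrC.
  by under eq_bigr do rewrite liftK.
exists (fun j => y (lift ord0 j)) => ij; rewrite comb.
apply: ((fourier_motzkin (fun i => g i p + \sum_j a i (lift ord0 j) * y (lift ord0 j))
  (fun i => a i ord0)).1 _ ij.1 ij.2).
exists (y ord0) => i; have := hy i; rewrite big_ord_recl; lra.
Qed.

(** Systems of finitely many inequalities linear in [y], with constant terms
    depending continuously on [p]. *)
Definition linear_system (T : topologicalType) (R : realType) m
    (S : T -> 'cV[R]_m -> Prop) : Prop :=
  exists (I : finType) (g : I -> T -> R) (a : I -> 'cV[R]_m),
    (forall i, continuous (g i)) /\
    (forall p y, S p y <-> forall i, 0 <= g i p + dotp (a i) y).

Section LinearSystems.
Variables (T : topologicalType) (R : realType) (m : nat).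
Implicit Types (S : T -> 'cV[R]_m -> Prop).

Lemma linear_system_closed S :
  linear_system S -> closed [set p | exists y, S p y].
Proof.
move=> [I [g [a [cg hS]]]].
have := @closed_projection _ _ m I g (fun i j => a i j 0) cg; congr closed.
apply/seteqP; split=> p /= [y hy].
  exists (\col_j y j); apply/hS => i; rewrite /dotp.
  by under eq_bigr do rewrite mxE; exact: hy.
by exists (fun j => y j 0) => i; move/hS: hy; exact.
Qed.

Lemma linear_system_ext S S' :
  (forall p y, S p y <-> S' p y) -> linear_system S -> linear_system S'.
Proof.
move=> SS' [I [g [a [cg hS]]]]; exists I, g, a; split=> // p y.
by rewrite -SS' hS.
Qed.

Lemma linear_system_ge0 (g : T -> R) (a : 'cV[R]_m) :
  continuous g -> linear_system (fun p y => 0 <= g p + dotp a y).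
Proof.
move=> cg; exists unit, (fun=> g), (fun=> a); split=> // p y.
by split=> [|/(_ tt)].
Qed.

Lemma linear_system_forall (J : finType) (S : J -> T -> 'cV[R]_m -> Prop) :
  (forall j, linear_system (S j)) -> linear_system (fun p y => forall j, S j p y).
Proof.
move=> hS.
pose I j := projT1 (cid (hS j)); pose h1 j := projT2 (cid (hS j)).
pose g j := projT1 (cid (h1 j)); pose h2 j := projT2 (cid (h1 j)).
pose a j := projT1 (cid (h2 j)); pose h3 j := projT2 (cid (h2 j)).
exists {j : J & I j}, (fun u => g (tag u) (tagged u)), (fun u => a (tag u) (tagged u)).
split=> [u|p y]; first exact: (h3 (tag u)).1.
split=> [h u|h j]; first exact: ((h3 (tag u)).2 p y).1 (h (tag u)) _.
by apply/((h3 j).2 p y) => i; exact: h (Tagged I i).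
Qed.

Lemma linear_system_and S S' :
  linear_system S -> linear_system S' -> linear_system (fun p y => S p y /\ S' p y).
Proof.
move=> hS hS'.
have := @linear_system_forall bool (fun e => if e then S else S').
have hSS' e : linear_system (if e then S else S') by case: e.
move=> /(_ hSS'); apply: linear_system_ext => p y; split=> [h|[h h'] []//].
by split; [exact: h true|exact: h false].
Qed.

Lemma linear_system_eq0 (g : T -> R) (a : 'cV[R]_m) :
  continuous g -> linear_system (fun p y => g p + dotp a y = 0).
Proof.
move=> cg; have cNg : continuous (fun p => - g p) by move=> p; apply: cvgN; exact: cg.
apply: linear_system_ext (linear_system_and (linear_system_ge0 a cg)
  (linear_system_ge0 (- a) cNg)) => p y.
rewrite dotpNl; split=> [[h h']|h]; last by split; lra.
by apply/eqP; rewrite eq_le; apply/andP; split; lra.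
Qed.

Lemma linear_system_imply (e : bool) S :
  (e -> linear_system S) -> linear_system (fun p y => e -> S p y).
Proof.
case: e => hS; first by apply: linear_system_ext (hS isT) => p y; split=> // h; exact: h.
by exists void, (fun=> fun=> 0), (fun=> 0); split=> // p y; split=> // _ [].
Qed.

End LinearSystems.

(** * Polyhedral factors *)

Definition polyhedral_cone (R : realType) n (C : set 'cV[R]_n) : Prop :=
  exists (I : finType) (f : I -> 'cV[R]_n), forall x, C x <-> forall i, 0 <= dotp (f i) x.

Lemma polyhedral0 (R : realType) n : polyhedral_cone [set (0 : 'cV[R]_n)].
Proof.
exists ('I_n * bool)%type, (fun u => (if u.2 then 1 else -1) *: delta_mx u.1 0) => x.
split=> [-> i|h]; first by rewrite dotp0r.
apply/matrixP => i j; rewrite ord1 mxE; apply/eqP; rewrite eq_le.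
have := h (i, true); have := h (i, false); rewrite !dotpZl !dotp_deltal /=; lra.
Qed.

Lemma polyhedral_half_line (R : realType) k (d : 'cV[R]_k.+1) :
  lorentz R k d -> polyhedral_cone (half_line d).
Proof.
move=> ld; have [->|/eqP dn0] := eqVneq d 0.
  rewrite (_ : half_line 0 = [set 0]); first exact: polyhedral0.
  apply/seteqP; split=> [_ [a _ <-]|_ ->]; first by rewrite /= scaler0.
  by exists 0; rewrite ?scaler0 //=.
have d0 := lorentz_gt0 ld dn0.
(* x lies on the ray iff x_0 >= 0 and d_0 x = x_0 d *)
have [J [f hf]] := polyhedral0 R k.+1.
pose M : 'M[R]_k.+1 := d ord0 0 *: 1%:M - d *m (delta_mx ord0 0)^T.
exists (option J), (fun u => if u is Some j then M^T *m f j else delta_mx ord0 0) => x.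
have Mx : M *m x = d ord0 0 *: x - x ord0 0 *: d.
  rewrite mulmxBl -scalemxAl mul1mx -mulmxA; congr (_ - _).
  rewrite [_ *m x](_ : _ = (x ord0 0)%:M); first by rewrite mul_mx_scalar.
  by apply/matrixP => i j; rewrite !ord1 -dotpE dotp_deltal mxE.
have fM j : dotp (M^T *m f j) x = dotp (f j) (M *m x).
  by rewrite dotpC dotp_mulmx dotpC.
split=> [[a a0 e] [j|]|h].
- by rewrite fM Mx -e mxE !scalerA mulrC subrr dotp0r.
- by rewrite -e dotpZr dotp_deltal mulr_ge0 // ltW.
have x0 : 0 <= x ord0 0 by have := h None; rewrite dotp_deltal.
have /hf /= : forall j, 0 <= dotp (f j) (M *m x).
  by move=> j; rewrite -fM; exact: h (Some j).
rewrite Mx => /eqP; rewrite subr_eq0 => /eqP e.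
exists (x ord0 0 / d ord0 0); first by rewrite /= divr_ge0 // ltW.
by rewrite mulrC -scalerA -e scalerA mulVf ?gt_eqF // scale1r.
Qed.

Lemma extended_soc_polyhedral (R : realType) q (k : 'I_q -> nat) (K : factors R k) i :
  extended_soc K -> K i <> lorentz R (k i) -> polyhedral_cone (K i).
Proof.
move=> /(_ i)[->|->|//|[[d [_ _ ->]]|[d [ld ->]]]] _.
- exact: polyhedral0.
- by exists void, (fun=> 0) => x; split=> // _ [].
- by exists unit, (fun=> d) => x; split=> [|/(_ tt)].
- exact: polyhedral_half_line.
Qed.
(** * Dual attainment *)

Section Attainment.
Variables (R : realType) (q m : nat) (k : 'I_q -> nat) (K : factors R k)
  (A : 'M[R]_(m, total_dim k)) (b : 'cV[R]_m) (c : 'cV[R]_(total_dim k)).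

#[local] Arguments K i _ : clear implicits.

Let isL (i : 'I_q) : bool := `[< K i = lorentz R (k i) >].

Definition block_proj (i : 'I_q) : 'M[R]_((k i).+1, total_dim k) :=
  @submxcol R q (fun j => (k j).+1) _ 1%:M i.

Lemma blockE (x : 'cV[R]_(total_dim k)) i : block x i = block_proj i *m x.
Proof. by rewrite /block_proj /block submxcol_mul mul1mx. Qed.

(** Puts a linear form of a block of the slack in the shape expected by
    [linear_system]: a constant term in [t] and a linear form in [y]. *)
Lemma dotp_block_slack i (f : 'cV[R]_(k i).+1) t y :
  dotp f (block (t *: c - A^T *m y) i) =
  t * dotp f (block c i) + dotp (- (A *m ((block_proj i)^T *m f))) y.
Proof.
rewrite blockD blockN blockZ dotpDr dotpZr dotpNr dotpNl; congr (_ - _).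
by rewrite blockE -[in LHS](trmxK (block_proj i)) !dotp_mulmx.
Qed.

(** The space of the triples [(s, (t, e))] of the compactness argument: a scaled
    slack, its scale, and the defect of the objective value. *)
Let param : Type := ('rV[R]_(total_dim k) * (R * R))%type.

(** On a product of Lorentz cones this linear form is nonnegative and vanishes
    only at the origin, so that it replaces a norm. *)
Let head_sum (s : 'rV[R]_(total_dim k)) : R :=
  \sum_(i | isL i) block s^T i ord0 0.

(** Among the slacks [z] of the homogenised problem, with objective at least
    [t theta - e], those with Lorentz blocks [s] and normalised by
    [t + head_sum s = 1].  The Lorentz constraints on [s] themselves, not being
    linear, are left out. *)
Let slack_system (theta : R) (p : param) (y : 'cV[R]_m) :=
  let z := p.2.1 *: c - A^T *m y in
  [/\ forall i, isL i -> forall r, block z i r 0 = block p.1^T i r 0,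
      forall i, ~~ isL i -> K i (block z i),
      p.2.1 * theta - p.2.2 <= dotp b y &
      p.2.1 + head_sum p.1 = 1].

Let continuous_blockT i r :
  continuous (fun p : param => block p.1^T i r 0).
Proof.
move=> p; rewrite (_ : (fun p => _) =
  (fun s : 'rV[R]_(total_dim k) => s 0 (tagnat.Rank i r)) \o fst).
  by apply: continuous_comp; [exact: cvg_fst|exact: coord_continuous].
by apply/funext => x; rewrite /= !mxE.
Qed.

Let continuous_t :
  continuous (fun p : param => p.2.1).
Proof.
move=> p; apply: (@continuous_comp _ _ _ snd fst); first exact: cvg_snd.
exact: cvg_fst.
Qed.

Let continuous_e :
  continuous (fun p : param => p.2.2).
Proof. by move=> p; apply: (@continuous_comp _ _ _ snd snd); exact: cvg_snd. Qed.

Lemma linear_slack_system theta :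
  extended_soc K -> linear_system (slack_system theta).
Proof.
move=> eK.
pose S1 (p : param) (y : 'cV[R]_m) :=
  forall i, isL i -> forall r, block (p.2.1 *: c - A^T *m y) i r 0 = block p.1^T i r 0.
pose S2 (p : param) (y : 'cV[R]_m) :=
  forall i, ~~ isL i -> K i (block (p.2.1 *: c - A^T *m y) i).
pose S3 (p : param) (y : 'cV[R]_m) :=
  p.2.1 * theta - p.2.2 <= dotp b y.
pose S4 (p : param) (y : 'cV[R]_m) :=
  p.2.1 + head_sum p.1 = 1.
have L1 : linear_system S1.
  apply: linear_system_forall => i; apply: linear_system_imply => _.
  apply: linear_system_forall => r.
  pose f : 'cV[R]_(k i).+1 := delta_mx r 0.
  have fE x : dotp f x = x r 0 by exact: dotp_deltal.
  apply: (@linear_system_ext _ R m (fun (p : param) y =>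
    (p.2.1 * dotp f (block c i) - block p.1^T i r 0) +
    dotp (- (A *m ((block_proj i)^T *m f))) y = 0)).
    move=> p y; rewrite -addrAC -dotp_block_slack fE.
    by split=> [/eqP|->]; rewrite ?subr_eq0 ?subrr // => /eqP.
  apply: linear_system_eq0 => p; apply: cvgB; last exact: continuous_blockT.
  by apply: cvgM; [exact: continuous_t|exact: cvg_cst].
have L2 : linear_system S2.
  apply: linear_system_forall => i; apply: linear_system_imply => nL.
  have nLi : K i <> lorentz R (k i) by move=> Ki; move: nL; rewrite /isL asboolT.
  have [J [f hf]] := extended_soc_polyhedral eK nLi.
  apply: (@linear_system_ext _ R m (fun (p : param) y => forall j,
    0 <= dotp (f j) (block (p.2.1 *: c - A^T *m y) i))).
    by move=> p y; rewrite hf.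
  apply: linear_system_forall => j.
  apply: (@linear_system_ext _ R m (fun (p : param) y =>
    0 <= p.2.1 * dotp (f j) (block c i) + dotp (- (A *m ((block_proj i)^T *m f j))) y)).
    by move=> p y; rewrite -dotp_block_slack.
  apply: linear_system_ge0 => p.
  by apply: cvgM; [exact: continuous_t|exact: cvg_cst].
have L3 : linear_system S3.
  apply: (@linear_system_ext _ R m (fun (p : param) y =>
    0 <= (p.2.2 - p.2.1 * theta) + dotp b y)).
    by move=> p y; rewrite /S3; split; lra.
  apply: linear_system_ge0 => p; apply: cvgB; first exact: continuous_e.
  by apply: cvgM; [exact: continuous_t|exact: cvg_cst].
have L4 : linear_system S4.
  apply: (@linear_system_ext _ R m (fun (p : param) y =>
    (p.2.1 + head_sum p.1 - 1) + dotp 0 y = 0)).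
    move=> p y; rewrite dotpC dotp0r addr0 /S4.
    by split=> [/eqP|->]; rewrite ?subr_eq0 ?subrr // => /eqP.
  apply: linear_system_eq0 => p; apply: cvgB; last exact: cvg_cst.
  apply: cvgD; first exact: continuous_t.
  by apply: continuous_sumr => i; exact: continuous_blockT.
apply: linear_system_ext (linear_system_and (linear_system_and L1 L2)
  (linear_system_and L3 L4)) => p y.
by split=> [[[h1 h2] [h3 h4]]|[h1 h2 h3 h4]]; split.
Qed.

Let box : set param :=
  [set s : 'rV[R]_(total_dim k) | forall r, s ord0 r \in `[-1, 1]%R]
  `*` (`[0, 1] `*` `[0, 1]).

Lemma box_compact : compact box.
Proof.
apply: compact_setX; last by apply: compact_setX; exact: segment_compact.
exact: (@rV_compact _ _ (fun=> [set x : R | x \in `[-1, 1]%R])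
  (fun=> @segment_compact R (-1) 1)).
Qed.

(** Defects [e] of points of the compact set [N] below form a closed set; it
    contains all [e] in [(0, 1]], by scaling [e]-optimal slacks, hence also [0]. *)
Lemma attainedD_no_direction y0 :
  extended_soc K -> feasibleD A c (direct_product K) y0 ->
  (forall w, direct_product K (A^T *m w) -> dotp b w = 0 ->
     forall i, K i = lorentz R (k i) -> block (A^T *m w) i = 0) ->
  valueD A b c (direct_product K) \is a fin_num ->
  attainedD A b c (direct_product K).
Proof.
move=> eK Fy0 nodir /valueD_fin_num[theta [valE ub appr]].
have cK := direct_product_cone (extended_soc_cone eK).
pose N := box `&` ([set p | forall i, isL i -> lorentz R (k i) (block p.1^T i)] `&`
  [set p | exists y, slack_system theta p y]).
have cN : compact N.
  apply: compact_closedI; first exact: box_compact.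
  apply: closedI; last exact: linear_system_closed (linear_slack_system theta eK).
  rewrite (_ : mkset _ = \bigcap_(i in [set i | isL i])
      [set p : param | lorentz R (k i) (block p.1^T i)]).
    apply: closed_bigI => i _; apply: closed_lorentz_comp => r.
    exact: continuous_blockT.
  by apply/seteqP; split=> p /=.
have approx (e : R) : 0 < e -> e <= 1 -> exists2 p, N p & p.2.2 = e.
  move=> e0 e1; have [y Fy lty] := appr e e0.
  pose z := c - A^T *m y; pose h := \sum_(i | isL i) block z i ord0 0.
  have lz i : isL i -> lorentz R (k i) (block z i).
    by move=> /asboolP Ki; rewrite -Ki; exact: Fy.
  have h0 : 0 <= h by apply: sumr_ge0 => i /lz /lorentzE[].
  (* the scale for which t + head_sum s = 1 *)
  pose l := (1 + h)^-1; have p0 : 0 < 1 + h by lra.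
  have l0 : 0 < l by rewrite invr_gt0.
  have l1 : l * (1 + h) = 1 by rewrite mulVf // gt_eqF.
  have lle : l <= 1 by rewrite invf_le1 //; lra.
  pose s : 'rV[R]_(total_dim k) := 
    (of_blocks (fun i => if isL i then l *: block z i else 0))^T.
  have sE i : isL i -> block s^T i = l *: block z i.
    by move=> Li; rewrite trmxK of_blocksK Li.
  have sE0 i : ~~ isL i -> block s^T i = 0.
    by move=> Li; rewrite trmxK of_blocksK (negPf Li).
  have zE : l *: c - A^T *m (l *: y) = l *: z by rewrite -scalemxAr -scalerBr.
  exists (s, (l, e)) => //; split; last split.
  - split=> /=; last first.
      by split; rewrite /= in_itv /= ?lle ?e1 ltW.
    move=> r; rewrite in_itv /= -ler_norml.
    have -> : s ord0 r = block s^T (tagnat.sig1 r) (tagnat.sig2 r) 0.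
      by rewrite !mxE tagnat.sig2K.
    have [Li|nLi] := boolP (isL (tagnat.sig1 r)); last by rewrite sE0 // mxE normr0.
    rewrite sE // mxE normrM gtr0_norm // -[leRHS]l1 ler_pM2l //.
    apply: le_trans (lorentz_coord _ (lz _ Li)) _.
    rewrite /h (bigD1 (tagnat.sig1 r)) //= addrCA lerDl addr_ge0 //.
    by apply: sumr_ge0 => i /andP[/lz/lorentzE[]].
  - move=> i Li /=; rewrite sE //; have [_ _ lZ] := lorentz_cone R (k i).
    by apply: lZ; [exact: ltW|exact: lz].
  - exists (l *: y); split=> /=.
    + by move=> i Li r; rewrite zE blockZ sE.
    + move=> i _; rewrite zE blockZ; have [_ _ KZ] := extended_soc_cone eK i.
      by apply: KZ; [exact: ltW|exact: Fy].
    + rewrite dotpZr.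
      have : l * (theta - e) <= l * dotp b y by rewrite ler_wpM2l // ltW.
      have : l * e <= 1 * e by rewrite ler_wpM2r // ltW.
      lra.
    + rewrite /head_sum; under eq_bigr => i Li do rewrite sE // mxE.
      by rewrite -mulr_sumr -/h -l1; ring.
have [p Np p0] : [set p.2.2 | p in N] 0.
  have cl : closed [set p.2.2 | p in N].
    apply: compact_closed; first exact: norm_hausdorff.
    apply: continuous_compact => //.
    by apply: continuous_subspaceT; exact: continuous_e.
  apply: cl => B /nbhs_ballP[e /= e0 he].
  pose e' := Num.min (e / 2) 1.
  have e'0 : 0 < e' by rewrite lt_min divr_gt0 // ltr01.
  have [|p Np pe] := approx e' e'0; first by rewrite ge_min lexx orbT.
  exists e'; split; first by exists p.
  apply: he; rewrite /ball /= sub0r normrN gtr0_norm //.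
  by rewrite gt_min ltr_pdivrMr // ltr_pMr // ltr1n.
case: Np => [[_ [/= t0 _]] [lp [y [hL hP hb hn]]]].
move: t0; rewrite in_itv /= => /andP[t0 _].
set t := p.2.1 in hL hP hb hn t0; pose z := t *: c - A^T *m y.
have Kz : direct_product K z.
  move=> i; have [Li|/hP //] := boolP (isL i).
  have -> : block z i = block p.1^T i by apply/matrixP => r j; rewrite ord1 hL.
  by move: (Li) => /asboolP ->; exact: lp.
(* a positive scale gives a solution, a zero scale a forbidden direction *)
have [tgt|tle] := ltP 0 t.
  have Fy : feasibleD A c (direct_product K) (t^-1 *: y).
    have [_ _ CZ] := cK; have t1 : 0 <= t^-1 by rewrite invr_ge0.
    have := CZ _ _ t1 Kz; rewrite /z scalerBr scalerA mulVf ?gt_eqF // scale1r.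
    by rewrite /feasibleD /= -scalemxAr.
  exists (t^-1 *: y); split=> //; rewrite valE; congr (_%:E).
  apply/eqP; rewrite eq_le ub //= dotpZr -(ler_pM2l tgt) mulrA mulfV ?gt_eqF //.
  by move: hb; rewrite p0 subr0 mul1r.
have {}tle : t = 0 by apply/eqP; rewrite eq_le tle.
have zE : z = A^T *m (- y) by rewrite /z tle scale0r sub0r mulmxN.
have by0 : dotp b (- y) = 0.
  have : dotp b y <= 0.
    by apply: recession_le0 cK _ _ _ ub Fy0 _; move: Kz; rewrite zE mulmxN.
  move: hb; rewrite tle p0 mul0r subr0 dotpNr => h1 h2; apply/eqP.
  by rewrite oppr_eq0 eq_le h1 h2.
have : head_sum p.1 = 0.
  apply: big1 => i Li; have zi : block z i = 0.
    by rewrite zE; apply: nodir => //; [rewrite -zE|exact/asboolP].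
  by rewrite -hL // -/z zi mxE.
by move: hn; rewrite tle add0r => -> /eqP; rewrite oner_eq0.
Qed.

End Attainment.

Theorem theorem11 (R : realType) (q m : nat) (k : 'I_q -> nat)
    (K : factors R k) (A : 'M[R]_(m, total_dim k)) (b : 'cV[R]_m)
    (c : 'cV[R]_(total_dim k)) (L : set 'cV[R]_(total_dim k)) (Ks : seq (factors R k)) :
  extended_soc K ->
  strongly_feasibleD A c (direct_product K) ->
  L = range (fun y : 'cV[R]_m => A^T *m y) `&`
      [set A^T *m y | y in [set y : 'cV[R]_m | dotp b y = 0]] ->
  maximal_relaxation_sequence K L Ks ->
  let Kg := direct_product (last K Ks) in
  [/\ (* (i) *)
      strongly_feasibleD A c Kg /\
      (valueD A b c Kg \is a fin_num -> attainedP A b c Kg)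
    & (* (ii) *)
      valueD A b c Kg = valueD A b c (direct_product K) /\
      (valueD A b c Kg \is a fin_num -> attainedD A b c Kg)].
Proof.
move=> eK sfK LE [[sz K1 eKs steps] maxi] Kg.
have inv i : (i < size Ks)%N ->
    strongly_feasibleD A c (direct_product (nth K Ks i)) /\
    valueD A b c (direct_product (nth K Ks i)) = valueD A b c (direct_product K).
  elim: i => [_|i IHi iS]; first by rewrite K1.
  have [sf v] := IHi (ltnW iS).
  have [[d [Kd Ld [_ _ _ ->]]] _] := steps i iS; have eKi := eKs i (ltnW iS).
  move: Ld; rewrite LE => -[_ [w bw dE]]; rewrite -dE in Kd *.
  by split; [exact: relaxation_strongly_feasible|rewrite relaxation_value].
have lt_last : ((size Ks).-1 < size Ks)%N by rewrite prednK.
have [sf v] := inv _ lt_last; have eKg := eKs _ lt_last.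
rewrite nth_last in sf v eKg.
have nodir w : Kg (A^T *m w) -> dotp b w = 0 ->
    forall i, last K Ks i = lorentz R (k i) -> block (A^T *m w) i = 0.
  move=> Kd bw i Ki; apply: contrapT => dn0; set d := A^T *m w in Kd dn0.
  apply: (maxi (relaxation d (last K Ks))); split.
  - by rewrite size_rcons.
  - by rewrite nth_rcons sz.
  - move=> j; rewrite size_rcons ltnS nth_rcons leq_eqVlt => /orP[/eqP ->|jS].
      by rewrite ltnn eqxx; exact: extended_soc_relaxation.
    by rewrite jS; exact: eKs.
  move=> j; rewrite size_rcons ltnS => jS; rewrite !nth_rcons jS.
  move: (jS); rewrite leq_eqVlt => /orP[/eqP jE|jlt]; last by rewrite jlt; exact: steps.
  rewrite jE ltnn eqxx.
  have -> : nth K Ks j = last K Ks by rewrite -nth_last -jE.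
  split; last exact: relaxation_proper Kd Ki dn0.
  exists d; split=> //; first by rewrite LE; split; [exists w|exists w].
  split=> //; last by exists i; exact: calH_block.
  by move=> d0; apply: dn0; rewrite d0 block0.
have cone := direct_product_cone (extended_soc_cone eKg).
have [y0 riy0] := sf.
split; split=> // fin.
  by apply: strong_duality => //; exists y0; exact: ri_rel_core.
exact: attainedD_no_direction (ri_sub riy0) nodir fin.
Qed.
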